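(* For all integers $m,n\ge 1$ we have \[\max_{\mathcal{A}}\min_{\mathcal{B}}\mathbb{E}[M_{m,n}(\mathcal{A},\mathcal{B})]=m,\] where the maximum and minimum range over all strategies in the Restricted Matching Pennies game. Moreover, if $\mathcal{U}$ is the strategy of choosing each card from the remaining deck uniformly at random, then for any strategies $\mathcal{A},\mathcal{B}$ we have \[\mathbb{E}[M_{m,n}(\mathcal{A},\mathcal{U})]=\mathbb{E}[M_{m,n}(\mathcal{U},\mathcal{B})]=m.\]
   Context: An $n$-vector is a vector $a=(a_1,\ldots,a_n)$ of non-negative integers ($a_i$ is the number of cards of type $i$ left in a deck). Let $\mathrm{supp}(a)=\{i:a_i>0\}$ and let $\delta_i$ be the $n$-vector with a 1 in position $i$ and 0's elsewhere. A strategy $\mathcal{A}$ in the Restricted Matching Pennies game is a function which takes in two nonzero $n$-vectors $a,b$ (in this order: own deck, opponent's deck) and outputs a random variable $\mathcal{A}(a,b)$ with support in $\mathrm{supp}(a)$. The players choose simultaneously: in each round the two players' choices are independent of each other and (given the current decks) of all earlier rounds. For $n$-vectors $a,b$ with $\sum a_i=\sum b_i$ and strategies $\mathcal{A},\mathcal{B}$, the score is defined recursively by $M(a,b,\mathcal{A},\mathcal{B})=0$ if $a=b=(0,\ldots,0)$, and otherwise \[M(a,b,\mathcal{A},\mathcal{B})=1_{\mathcal{A}(a,b)=\mathcal{B}(b,a)}+M(a-\delta_{\mathcal{A}(a,b)},\,b-\delta_{\mathcal{B}(b,a)},\mathcal{A},\mathcal{B}).\] Define $M_{m,n}(\mathcal{A},\mathcal{B})=M(a,b,\mathcal{A},\mathcal{B})$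 with $a=b=(m,\ldots,m)$ of length $n$. The strategy $\mathcal{U}$ is given by $\Pr[\mathcal{U}(a,b)=i]=a_i/\sum_j a_j$. *)

(* Defs.v *)
From HB Require Import structures.
From mathcomp Require Import all_boot all_order all_algebra.
From mathcomp Require Import reals.

Set Implicit Arguments.
Unset Strict Implicit.
Unset Printing Implicit Defensive.

Import Order.TTheory GRing.Theory Num.Theory.
Local Open Scope ring_scope.

Notation deck n := {ffun 'I_n -> nat}.

Definition deck_size n (a : deck n) : nat := (\sum_(i < n) a i)%N.

Definition full_deck n (m : nat) : deck n := [ffun=> m].

(* The difference is truncated, but a card that is not in the deck is drawn
   with probability 0. *)
Definition remove_card n (a : deck n) (i : 'I_n) : deck n :=
  [ffun k => (a k - (k == i))%N].

(* [prob a b i] is Pr[A(a,b) = i], with [a] the player's own deck and [b] the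
   opponent's. Only pairs of nonzero decks are constrained: the values of [prob]
   at other pairs play no role in a game between decks of equal size. *)
Record strategy (R : realType) (n : nat) := Strategy {
  prob : deck n -> deck n -> 'I_n -> R;
  prob_ge0 : forall a b : deck n,
    a != [ffun=> 0%N] -> b != [ffun=> 0%N] -> forall i, 0 <= prob a b i;
  prob_sum1 : forall a b : deck n,
    a != [ffun=> 0%N] -> b != [ffun=> 0%N] -> \sum_(i < n) prob a b i = 1;
  prob_supp : forall a b : deck n,
    a != [ffun=> 0%N] -> b != [ffun=> 0%N] ->
    forall i, a i = 0%N -> prob a b i = 0
}.

(* A play lists, round by round, the pair of cards (first player, second player)
   that are drawn. [play_prob A B a b w] is the probability that the game started
   with decks [a] and [b] goes as [w]: given the current decks, the two draws of
   a round are independent of each other and of the earlier rounds. *)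
Fixpoint play_prob (R : realType) n (A B : strategy R n) (a b : deck n)
    (w : seq ('I_n * 'I_n)) : R :=
  if w is (i, j) :: w' then
    prob A a b i * prob B b a j
      * play_prob A B (remove_card a i) (remove_card b j) w'
  else 1.

Fixpoint score n (w : seq ('I_n * 'I_n)) : nat :=
  if w is (i, j) :: w' then ((i == j) + score w')%N else 0%N.

(* E[M(a, b, A, B)], for decks of equal size; the sample space is the finite set
   of plays whose length is this size, with weights [play_prob]. *)
Definition expected_score (R : realType) n (a b : deck n)
    (A B : strategy R n) : R :=
  \sum_(w : (deck_size a).-tuple ('I_n * 'I_n))
    play_prob A B a b w * (score w)%:R.

(* E[M_{m,n}(A, B)] *)
Definition expected_M (R : realType) (m n : nat) (A B : strategy R n) : R :=
  expected_score (full_deck n m) (full_deck n m) A B.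

Definition uniform_prob (R : realType) n (a b : deck n) (i : 'I_n) : R :=
  (a i)%:R / (deck_size a)%:R.

Lemma uniform_prob_ge0 (R : realType) n (a b : deck n) :
  a != [ffun=> 0%N] -> b != [ffun=> 0%N] ->
  forall i, 0 <= uniform_prob R a b i.
Proof. by move=> _ _ i; rewrite divr_ge0 ?ler0n. Qed.

Lemma uniform_prob_sum1 (R : realType) n (a b : deck n) :
  a != [ffun=> 0%N] -> b != [ffun=> 0%N] ->
  \sum_(i < n) uniform_prob R a b i = 1.
Proof.
move=> a0 _; rewrite -mulr_suml -natr_sum mulfV // pnatr_eq0.
apply: contra a0 => /eqP h; apply/eqP/ffunP => i; rewrite ffunE.
by move/eqP: h; rewrite sum_nat_eq0 => /forallP/(_ i)/eqP.
Qed.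

Lemma uniform_prob_supp (R : realType) n (a b : deck n) :
  a != [ffun=> 0%N] -> b != [ffun=> 0%N] ->
  forall i, a i = 0%N -> uniform_prob R a b i = 0.
Proof. by move=> _ _ i ai; rewrite /uniform_prob ai mul0r. Qed.

Definition uniform_strategy (R : realType) n : strategy R n :=
  Strategy (@uniform_prob_ge0 R n) (@uniform_prob_sum1 R n)
           (@uniform_prob_supp R n).

(* Attained extrema, not mere infima and suprema. *)
Definition is_min_of (R : realType) (I : Type) (f : I -> R) (v : R) : Prop :=
  (exists i, f i = v) /\ forall i, v <= f i.

Definition is_max_of (R : realType) (I : Type) (f : I -> R) (v : R) : Prop :=
  (exists i, f i = v) /\ forall i, f i <= v.

(* Every inner minimum exists, and the largest of these minima is [v]. *)
Definition is_maxmin_of (R : realType) (I J : Type) (f : I -> J -> R) (v : R) :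
    Prop :=
  exists g : I -> R, (forall i, is_min_of (f i) (g i)) /\ is_max_of g v.

(* Main.v *)
(* Against the uniform strategy every strategy has expected score
   [\sum_k a_k b_k / N] when started with decks [a], [b] of size [N]: this is
   proved by induction on [N], and equals [m] for two full decks. By symmetry the
   same holds when the uniform strategy moves first. Hence no strategy guarantees
   more than [m], and the uniform one guarantees [m]. The inner minima are
   attained by backward induction: against a fixed [A], always drawing a card
   that minimizes the expected remaining score is a best response. *)
Require Import Defs.
From mathcomp Require Import all_boot all_order all_algebra.
From mathcomp Require Import reals ring.

Import Order.TTheory GRing.Theory Num.Theory.

Local Open Scope ring_scope.

Section Game.
Context {R : realType} {n : nat}.
Implicit Types (a b : deck n) (A B : strategy R n) (i j k : 'I_n) (N : nat).

(** * Decks and averages over a single draw *)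

Lemma deck_sizeS_neq0 {N a} : deck_size a = N.+1 -> a != [ffun=> 0%N].
Proof.
move=> sa; apply/eqP => a0; move: sa; rewrite a0 /deck_size.
by rewrite big1 // => i _; rewrite ffunE.
Qed.

Lemma deck_size_remove {N a i} :
  deck_size a = N.+1 -> (0 < a i)%N -> deck_size (remove_card a i) = N.
Proof.
rewrite /deck_size (bigD1 i) //= [in X in _ -> _ -> X](bigD1 i) //= !ffunE eqxx.
have -> : (\sum_(k < n | k != i) remove_card a i k = \sum_(k < n | k != i) a k)%N.
  by apply: eq_bigr => k /negbTE ki; rewrite ffunE ki subn0.
by case: (a i) => // c; rewrite addSn subn1 => -[].
Qed.

(** Cards outside [a] have probability 0, so [F] and [G] need comparing only on cards that can be
    drawn; for these, [deck_size_remove] makes induction hypotheses applicable. *)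
Lemma ler_sum_prob A a b (F G : 'I_n -> R) :
  a != [ffun=> 0%N] -> b != [ffun=> 0%N] ->
  (forall i, (0 < a i)%N -> F i <= G i) ->
  \sum_i prob A a b i * F i <= \sum_i prob A a b i * G i.
Proof.
move=> a0 b0 FG; apply: ler_sum => i _; case: (posnP (a i)) => [ai|/FG ai].
  by rewrite prob_supp // !mul0r.
by rewrite ler_wpM2l // prob_ge0.
Qed.

Lemma eq_sum_prob A a b (F G : 'I_n -> R) :
  a != [ffun=> 0%N] -> b != [ffun=> 0%N] ->
  (forall i, (0 < a i)%N -> F i = G i) ->
  \sum_i prob A a b i * F i = \sum_i prob A a b i * G i.
Proof.
by move=> a0 b0 FG; apply: le_anti; apply/andP; split; apply: ler_sum_prob;
  rewrite // => i /FG ->.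
Qed.

Lemma sum_prob_const A a b (c : R) :
  a != [ffun=> 0%N] -> b != [ffun=> 0%N] ->
  \sum_i prob A a b i * c = c.
Proof. by move=> a0 b0; rewrite -mulr_suml prob_sum1 // mul1r. Qed.

(** * Round-by-round recursion for the expected score *)

Lemma big_tuple_pairS N (F : seq ('I_n * 'I_n) -> R) :
  \sum_(w : N.+1.-tuple ('I_n * 'I_n)) F w =
  \sum_i \sum_j \sum_(w : N.-tuple ('I_n * 'I_n)) F ((i, j) :: w).
Proof.
rewrite pair_bigA pair_bigA /=.
rewrite (reindex (fun p : ('I_n * 'I_n) * N.-tuple ('I_n * 'I_n) =>
  [tuple of p.1 :: p.2])) /=.
  by apply: eq_bigr => -[[i j] w].
exists (fun w : N.+1.-tuple _ => (thead w, [tuple of behead w])).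
  by case=> x w _ /=; rewrite theadE; congr pair; apply: val_inj.
by move=> w _; rewrite [RHS]tuple_eta; apply: val_inj.
Qed.

(** The length [N] is a parameter separate from [deck_size a], so that induction on [N] can change
    the decks without transporting tuples between types. *)
Definition value N a b A B : R :=
  \sum_(w : N.-tuple ('I_n * 'I_n)) play_prob A B a b w * (score w)%:R.

Lemma value0 a b A B : value 0 a b A B = 0.
Proof. by apply: big1 => w _; rewrite tuple0 /= mulr0. Qed.

Lemma sum_play_prob N a b A B : deck_size a = N -> deck_size b = N ->
  \sum_(w : N.-tuple ('I_n * 'I_n)) play_prob A B a b w = 1.
Proof.
elim: N a b => [|N IH] a b sa sb.
  rewrite (eq_bigr (fun=> 1)) => [|w _]; last by rewrite tuple0.
  by rewrite sumr_const card_tuple expn0.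
have [a0 b0] := (deck_sizeS_neq0 sa, deck_sizeS_neq0 sb).
rewrite big_tuple_pairS /=.
rewrite -[RHS](sum_prob_const A _ _ 1 a0 b0).
under eq_bigr => i _ do under eq_bigr => j _ do rewrite -mulr_sumr -mulrA.
under eq_bigr => i _ do rewrite -mulr_sumr.
apply: eq_sum_prob => // i ai; rewrite -[RHS](sum_prob_const B _ _ 1 b0 a0).
by apply: eq_sum_prob => // j bj; rewrite IH //; apply: deck_size_remove.
Qed.

(** The match indicator of the first round does not depend on the later rounds, whose plays have
    total weight 1 by [sum_play_prob]. *)
Lemma valueS N a b A B : deck_size a = N.+1 -> deck_size b = N.+1 ->
  value N.+1 a b A B =
  \sum_i prob A a b i * \sum_j prob B b a j *
    ((i == j)%:R + value N (remove_card a i) (remove_card b j) A B).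
Proof.
move=> sa sb; have [a0 b0] := (deck_sizeS_neq0 sa, deck_sizeS_neq0 sb).
rewrite /value (big_tuple_pairS _ (fun w => play_prob A B a b w * (score w)%:R)) /=.
under eq_bigr => i _ do under eq_bigr => j _ do under eq_bigr => w _
  do rewrite -!mulrA natrD mulrDr.
under eq_bigr => i _ do under eq_bigr => j _ do rewrite -!mulr_sumr big_split /=
  -mulr_suml.
under eq_bigr => i _ do rewrite -mulr_sumr.
apply: eq_sum_prob => // i ai; apply: eq_sum_prob => // j bj.
by rewrite sum_play_prob ?mul1r //; apply: deck_size_remove.
Qed.

(** The two draws of a round are independent, so the sums over them can be exchanged, and a match is
    symmetric in the players. *)
Lemma valueC N a b A B : deck_size a = N -> deck_size b = N ->
  value N a b A B = value N b a B A.
Proof.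
elim: N a b => [|N IH] a b sa sb; first by rewrite !value0.
have [a0 b0] := (deck_sizeS_neq0 sa, deck_sizeS_neq0 sb).
rewrite !valueS //.
under [RHS]eq_bigr => j _ do rewrite mulr_sumr.
rewrite exchange_big /=.
under [RHS]eq_bigr => i _ do under eq_bigr => j _ do rewrite mulrCA.
under [RHS]eq_bigr => i _ do rewrite -mulr_sumr.
apply: eq_sum_prob => // i ai; apply: eq_sum_prob => // j bj.
by rewrite eq_sym IH //; apply: deck_size_remove.
Qed.

(** * Playing against the uniform strategy *)

Lemma natr_remove_card a i k : (0 < a i)%N ->
  (remove_card a i k)%:R = (a k)%:R - (k == i)%:R :> R.
Proof. by move=> ai; rewrite ffunE natrB //; case: eqP => // ->. Qed.

(** If [i] is drawn from [a], the uniform opponent matches it with probability [b i / N]. This makes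
    up exactly for the term that the loss of [i] removes from the expected remaining score, so all
    cards of [a] are equally good. *)
Lemma value_uniformr N a b A : deck_size a = N -> deck_size b = N ->
  value N a b A (uniform_strategy R n) =
  (\sum_k (a k)%:R * (b k)%:R) / N%:R.
Proof.
elim: N a b => [|N IH] a b sa sb; first by rewrite value0 invr0 mulr0.
have [a0 b0] := (deck_sizeS_neq0 sa, deck_sizeS_neq0 sb).
rewrite valueS // -[RHS](sum_prob_const A _ _ _ a0 b0).
apply: eq_sum_prob => // i ai.
have sai := deck_size_remove sa ai.
transitivity (\sum_j prob (uniform_strategy R n) b a j * ((i == j)%:R +
   \sum_k (remove_card a i k)%:R / N%:R * ((b k)%:R - (k == j)%:R))).
  apply: eq_sum_prob => // j bj; rewrite IH ?(deck_size_remove sb) // mulr_suml.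
  congr (_ + _); apply: eq_bigr => k _; rewrite (natr_remove_card b) //.
  by rewrite mulrAC.
have sumb : \sum_j (b j)%:R = N.+1%:R :> R by rewrite -natr_sum -sb.
have sum_eq (c : R) k : \sum_j (b j)%:R * (c * (k == j)%:R) = (b k)%:R * c.
  rewrite (bigD1 k) //= eqxx mulr1 big1 ?addr0 // => j /negbTE jk.
  by rewrite eq_sym jk !mulr0.
rewrite /= /uniform_prob sb.
under eq_bigr => j _ do rewrite mulrAC.
rewrite -mulr_suml; congr (_ / _).
under [LHS]eq_bigr => j _ do rewrite mulrDr mulr_sumr.
rewrite big_split /= exchange_big /=.
rewrite (eq_bigr (fun j => (b j)%:R * (1 * (i == j)%:R))) => [|j _]; last by rewrite mul1r.
rewrite sum_eq mulr1.
(* The sum over [j] of [b j * (b k - [k = j])] is [(N + 1) * b k - b k = N * b k], which cancels the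
   division by [N]. *)
have drawn k : \sum_j (b j)%:R * ((remove_card a i k)%:R / N%:R *
    ((b k)%:R - (k == j)%:R)) = ((a k)%:R - (k == i)%:R) * (b k)%:R :> R.
  under eq_bigr => j _ do rewrite mulrBr mulrBr.
  rewrite sumrB sum_eq -mulr_suml sumb -natr_remove_card //.
  (* For [N = 0] the inverse of [N] is 0 by convention and nothing cancels, but then
     [remove_card a i] is empty and both sides vanish. *)
  have [N0|N0] := posnP N; last first.
    have : N%:R != 0 :> R by rewrite pnatr_eq0 -lt0n.
    by rewrite -natr1 => ?; field.
  have -> : remove_card a i k = 0%N; last by rewrite !mul0r !mulr0 subr0.
  move: sai; rewrite N0 => /eqP; rewrite sum_nat_eq0 => /forallP/(_ k)/eqP.
  exact.
under eq_bigr => k _ do rewrite drawn mulrBl.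
rewrite sumrB [X in _ - X](bigD1 i) //= eqxx mul1r [X in _ - (_ + X)]big1.
  by rewrite addr0 addrC subrK.
by move=> k /negbTE ->; rewrite mul0r.
Qed.

(** * Best responses by backward induction *)

Definition best_card (F : 'I_n -> R) b : option 'I_n :=
  omap (fun j0 => [arg min_(j < j0 | (0 < b j)%N) F j]%O) [pick j | (0 < b j)%N].

Lemma best_cardP (F : 'I_n -> R) b : b != [ffun=> 0%N] ->
  exists j, [/\ best_card F b = Some j, (0 < b j)%N &
                forall k, (0 < b k)%N -> F j <= F k].
Proof.
move=> b0; rewrite /best_card; case: pickP => [j0 bj0|b00] /=; last first.
  case/eqP: b0; apply/ffunP => i; rewrite ffunE.
  by have := b00 i; rewrite lt0n => /negbFE/eqP.
by exists [arg min_(j < j0 | (0 < b j)%N) F j]%O; case: arg_minP => // j bj jmin.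
Qed.

Fixpoint best_value A N a b : R :=
  if N is N'.+1 then
    let F j := \sum_i prob A a b i *
      ((i == j)%:R + best_value A N' (remove_card a i) (remove_card b j)) in
    if best_card F b is Some j then F j else 0
  else 0.

(** The local [F] of [best_value], named so that [response_prob] can refer to it. *)
Definition draw_value A N a b j : R :=
  \sum_i prob A a b i *
    ((i == j)%:R + best_value A N (remove_card a i) (remove_card b j)).

(** A point mass at a minimizing card. A strategy sees only the decks, so the number of rounds left
    after this one is recovered as [(deck_size a).-1]. *)
Definition response_prob A b a j : R :=
  (best_card (draw_value A (deck_size a).-1 a b) b == Some j)%:R.

Lemma response_prob_ge0 A b a : b != [ffun=> 0%N] -> a != [ffun=> 0%N] ->
  forall j, 0 <= response_prob A b a j.
Proof. by move=> *; apply: ler0n. Qed.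

Lemma sum_response A b a (G : 'I_n -> R) j :
  best_card (draw_value A (deck_size a).-1 a b) b = Some j ->
  \sum_k response_prob A b a k * G k = G j.
Proof.
move=> bj; rewrite /response_prob bj (bigD1 j) //= eqxx mul1r big1 ?addr0 //.
by move=> k kj; rewrite (inj_eq Some_inj) eq_sym (negbTE kj) mul0r.
Qed.

Lemma response_prob_sum1 A b a : b != [ffun=> 0%N] -> a != [ffun=> 0%N] ->
  \sum_j response_prob A b a j = 1.
Proof.
move=> b0 _; have [j [bj _ _]] := best_cardP (draw_value A (deck_size a).-1 a b) _ b0.
by rewrite -[RHS](sum_response _ _ _ (fun=> 1) _ bj); apply: eq_bigr => k; rewrite mulr1.
Qed.

Lemma response_prob_supp A b a : b != [ffun=> 0%N] -> a != [ffun=> 0%N] ->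
  forall j, b j = 0%N -> response_prob A b a j = 0.
Proof.
move=> b0 _ j bj0; have [k [bk bk0 _]] := best_cardP (draw_value A (deck_size a).-1 a b) _ b0.
rewrite /response_prob bk (inj_eq Some_inj); case: eqP => // kj.
by rewrite kj bj0 in bk0.
Qed.

Definition best_response A : strategy R n :=
  Strategy (response_prob_ge0 A) (response_prob_sum1 A) (response_prob_supp A).

Lemma value_best_response N a b A : deck_size a = N -> deck_size b = N ->
  value N a b A (best_response A) = best_value A N a b.
Proof.
elim: N a b => [|N IH] a b sa sb; first by rewrite value0.
have [a0 b0] := (deck_sizeS_neq0 sa, deck_sizeS_neq0 sb).
have [j [bj bj0 _]] := best_cardP (draw_value A N a b) _ b0.
rewrite valueS //= -/(draw_value A N a b) bj.
apply: eq_sum_prob => // i ai; rewrite (sum_response _ _ _ _ j) ?sa //.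
by rewrite IH //; apply: deck_size_remove.
Qed.

(** An average over the draws of [B] cannot fall below the minimum over the cards of [b]. *)
Lemma best_value_le N a b A B : deck_size a = N -> deck_size b = N ->
  best_value A N a b <= value N a b A B.
Proof.
elim: N a b => [|N IH] a b sa sb; first by rewrite value0.
have [a0 b0] := (deck_sizeS_neq0 sa, deck_sizeS_neq0 sb).
have [j [bj bj0 jmin]] := best_cardP (draw_value A N a b) _ b0.
(* Swapping the players makes the draw of [B] the outer sum; the swap is undone in the remaining
   game below. *)
rewrite valueC // valueS //= -/(draw_value A N a b) bj.
rewrite -[leLHS](sum_prob_const B _ _ _ b0 a0).
apply: ler_sum_prob => // k bk; apply: le_trans (jmin k bk) _.
apply: ler_sum_prob => // i ai; rewrite eq_sym lerD2l valueC ?IH //;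
  exact: deck_size_remove.
Qed.

End Game.

Theorem proposition1p5 (R : realType) (m n : nat)
    (hm : (1 <= m)%N) (hn : (1 <= n)%N) :
  is_maxmin_of (fun A B : strategy R n => expected_M m A B) m%:R
  /\ forall A B : strategy R n,
       expected_M m A (uniform_strategy R n) = m%:R
       /\ expected_M m (uniform_strategy R n) B = m%:R.
Proof.
set U := uniform_strategy R n; set d := full_deck n m.
have sd : deck_size d = (n * m)%N.
  rewrite /deck_size (eq_bigr (fun=> m)) => [|i _]; last by rewrite ffunE.
  by rewrite sum_nat_const card_ord.
have expE (A B : strategy R n) : expected_M m A B = value (deck_size d) d d A B by [].
have UR A : expected_M m A U = m%:R.
  rewrite expE value_uniformr // sd.
  rewrite (eq_bigr (fun=> m%:R * m%:R)) => [|i _]; last by rewrite ffunE.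
  rewrite sumr_const card_ord -mulr_natl natrM.
  have m0 : m%:R != 0 :> R by rewrite pnatr_eq0 -lt0n.
  have n0 : n%:R != 0 :> R by rewrite pnatr_eq0 -lt0n.
  by field; rewrite m0.
have UL B : expected_M m U B = m%:R by rewrite expE valueC // -expE UR.
split; last by [].
exists (fun A => expected_M m A (best_response A)).
have minA (A : strategy R n) : is_min_of (expected_M m A) (expected_M m A (best_response A)).
  split=> [|B]; first by exists (best_response A).
  by rewrite !expE value_best_response // best_value_le.
(* The maximum is attained at [U], which scores [m] against every opponent; the minimum for any [A]
   is at most its score [m] against [U]. *)
split=> //; split=> [|A]; first by exists U.
by rewrite -(UR A); apply: (minA A).2.
Qed.
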